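(* Let $\Phi\in\mathcal{E}^\Gamma(I)$. Then $\sqrt{\Phi}$ and the map $t\mapsto t^{-1}\Phi(t)$ are subadditive on $(0,\ell(I))$. If, in addition, $\varphi:[0,\ell(I))\to[0,\infty)$ is decreasing on $(0,\ell(I))$, then $\varphi\cdot\Phi\in\mathcal{E}^\Gamma(I)$. In particular, if $\Psi\in\mathcal{E}(I)$ and $t\mapsto t^{-2}\Psi(t)$ is decreasing on $(0,\ell(I))$, then $\Psi\in\mathcal{E}^\Gamma(I)$.
   Context: $I\subseteq\mathbb{R}$ is a nonempty open interval and $\ell(I)\in(0,\infty]$ is its length. $\mathcal{E}(I)$ is the set of all functions $\Phi:[0,\ell(I))\to[0,\infty)$ (called error functions). $\mathcal{E}^\Gamma(I)$ is the set of those $\Phi\in\mathcal{E}(I)$ possessing property $\Gamma$, i.e., satisfying $$\Phi(x+y)\leq\Phi(x)+\frac{2x+y}{y}\Phi(y)\qquad(x\geq0,\ y>0,\ x+y<\ell(I)).$$ A function $h:(0,\ell(I))\to\mathbb{R}$ is subadditive on $(0,\ell(I))$ if $h(x+y)\leq h(x)+h(y)$ for all $x,y>0$ with $x+y<\ell(I)$. ''Decreasing'' is meant in the non-strict sense. *)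

(* Defs.v *)
From mathcomp Require Import all_boot all_order all_algebra.
From mathcomp Require Import all_classical all_reals all_analysis.

Set Implicit Arguments.
Unset Strict Implicit.
Unset Printing Implicit Defensive.

Import Order.TTheory GRing.Theory Num.Theory.
Import numFieldNormedType.Exports.

Local Open Scope classical_set_scope.
Local Open Scope ring_scope.

Section ErrorFunctions.
Variable R : realType.
Implicit Types (I : set R) (f h Phi : R -> R).

Definition ilength I : \bar R :=
  (ereal_sup (EFin @` I) - ereal_inf (EFin @` I))%E.

(* [0, ilength I[ and ]0, ilength I[, where ilength I may be +oo *)
Definition dom I : set R := [set t | 0 <= t /\ (t%:E < ilength I)%E].
Definition posdom I : set R := [set t | 0 < t /\ (t%:E < ilength I)%E].

(* A function [0, ilength I[ -> [0, +oo[ is represented by a total function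
   R -> R of which only the values on dom I are constrained or used. *)
Definition error_fun I : set (R -> R) :=
  [set Phi | set_fun (dom I) [set y | 0 <= y] Phi].

Definition error_fun_Gamma I : set (R -> R) :=
  [set Phi | error_fun I Phi /\
    forall x y, 0 <= x -> 0 < y -> ((x + y)%:E < ilength I)%E ->
      Phi (x + y) <= Phi x + (2 * x + y) / y * Phi y].

Definition subadditive_on I h : Prop :=
  forall x y, 0 < x -> 0 < y -> ((x + y)%:E < ilength I)%E ->
    h (x + y) <= h x + h y.

Definition decreasing_on I f : Prop :=
  forall x y, posdom I x -> posdom I y -> x <= y -> f y <= f x.

End ErrorFunctions.

(* Main.v *)
Require Import Defs.
From mathcomp Require Import all_boot all_order all_algebra.
From mathcomp Require Import all_classical all_reals all_analysis.
From mathcomp Require Import ring lra.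
Import Order.TTheory GRing.Theory Num.Theory.
Import numFieldNormedType.Exports.
Local Open Scope classical_set_scope.
Local Open Scope ring_scope.

(** Property Gamma reads
      [Phi (x + y) <= Phi x + Phi y + 2 * (x / y) * Phi y],
    and exchanging [x] and [y] replaces the last term, the excess over
    additivity, by [2 * (y / x) * Phi x]. Subadditivity of [Phi t / t] says
    that the arithmetic mean of the two excesses is an admissible excess, and
    subadditivity of [sqrt Phi] that their geometric mean
    [2 * sqrt (Phi x) * sqrt (Phi y)] is one; both means are at least the
    minimum ([subadditive_divt], [subadditive_sqrt]).

    Multiplication by a nonnegative decreasing [phi] preserves the inequality
    because [phi (x + y)] is at most [phi x] and [phi y]
    ([error_fun_Gamma_mul]). The value [phi 0] is not controlled by
    monotonicity on the positive numbers, but for [x = 0] the inequality says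
    only [0 <= Phi 0], so only positive [x] matters ([error_fun_Gamma_pos]).

    Finally [t ^+ 2] has property Gamma, with equality, and [Psi] is the
    product of the decreasing [t ^- 2 * Psi t] with it, except possibly at
    [0], which again is harmless. *)

Section PropertyGamma.
Variables (R : realType) (I : set R).
Implicit Types (x y : R) (Phi Psi phi : R -> R).

Lemma ilength_ltW {x y} : x <= y -> (y%:E < ilength I)%E ->
  (x%:E < ilength I)%E.
Proof. by move=> xy; apply: le_lt_trans; rewrite lee_fin. Qed.

Lemma posdom_summands {x y} : 0 < x -> 0 < y ->
  ((x + y)%:E < ilength I)%E -> [/\ posdom I x, posdom I y & posdom I (x + y)].
Proof.
move=> x0 y0 xyI; split; split; rewrite ?addr_gt0 //.
- by apply: ilength_ltW xyI; rewrite lerDl ltW.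
- by apply: ilength_ltW xyI; rewrite lerDr ltW.
Qed.

Lemma posdom_dom {x} : posdom I x -> dom I x.
Proof. by move=> [/ltW]. Qed.

(** At [x = 0] the inequality reduces to nonnegativity of [Phi 0]. *)
Lemma error_fun_Gamma_pos {Phi} : error_fun I Phi ->
  (forall x y, 0 < x -> 0 < y -> ((x + y)%:E < ilength I)%E ->
     Phi (x + y) <= Phi x + (2 * x + y) / y * Phi y) ->
  error_fun_Gamma I Phi.
Proof.
move=> Phi_ge0 PhiG; split=> // x y; rewrite le_eqVlt => /predU1P[<-|x0].
  move=> y0 xyI; rewrite mulr0 !add0r divff ?gt_eqF // mul1r lerDr.
  apply: Phi_ge0; split=> //.
  by apply: ilength_ltW xyI; rewrite add0r ltW.
exact: PhiG.
Qed.

Lemma error_fun_Gamma_excess {Phi x y} : error_fun_Gamma I Phi ->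
  0 < x -> 0 < y -> ((x + y)%:E < ilength I)%E ->
  Phi (x + y) <= Phi x + Phi y + 2 * (x / y * Phi y).
Proof.
move=> [_ PhiG] x0 y0 xyI; apply: (le_trans (PhiG _ _ (ltW x0) y0 xyI)).
by rewrite le_eqVlt; apply/predU1P; left; field; rewrite gt_eqF.
Qed.

(** Whichever of [x * sqrt (Phi y)] and [y * sqrt (Phi x)] is smaller tells
    which of the two excesses lies below their geometric mean. *)
Lemma subadditive_sqrt {Phi} : error_fun_Gamma I Phi ->
  subadditive_on I (fun t => Num.sqrt (Phi t)).
Proof.
move=> PhiG x y; wlog le_xy : x y / x * Num.sqrt (Phi y) <= y * Num.sqrt (Phi x).
  move=> H x0 y0 xyI.
  have [le|/ltW le] := leP (x * Num.sqrt (Phi y)) (y * Num.sqrt (Phi x)).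
    exact: H.
  by rewrite addrC (addrC (Num.sqrt _)); apply: H; rewrite // addrC.
move=> x0 y0 xyI; have [xI yI _] := posdom_summands x0 y0 xyI.
have Phix := PhiG.1 _ (posdom_dom xI); have Phiy := PhiG.1 _ (posdom_dom yI).
rewrite -[leRHS]ger0_norm ?addr_ge0 ?sqrtr_ge0 // -sqrtr_sqr ler_wsqrtr //.
apply: (le_trans (error_fun_Gamma_excess PhiG x0 y0 xyI)).
rewrite sqrrD !sqr_sqrtr // [leRHS]addrAC lerD2l -[leRHS]mulr_natl ler_wpM2l //.
rewrite -{1}(sqr_sqrtr Phiy) expr2 mulrA ler_wpM2r ?sqrtr_ge0 //.
by rewrite mulrAC ler_pdivrMr // (mulrC _ y).
Qed.

Lemma subadditive_divt {Phi} : error_fun_Gamma I Phi ->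
  subadditive_on I (fun t => t^-1 * Phi t).
Proof.
move=> PhiG x y x0 y0 xyI; have xy0 : 0 < x + y by rewrite addr_gt0.
have yxI : ((y + x)%:E < ilength I)%E by rewrite addrC.
have ex := error_fun_Gamma_excess PhiG x0 y0 xyI.
have ey := error_fun_Gamma_excess PhiG y0 x0 yxI.
rewrite (addrC y) in ey.
rewrite mulrC ler_pdivrMr //.
(* This is the average of the two bounds [ex] and [ey]. *)
have -> : (x^-1 * Phi x + y^-1 * Phi y) * (x + y) =
    Phi x + Phi y + x / y * Phi y + y / x * Phi x.
  by field; rewrite !gt_eqF.
lra.
Qed.

Lemma error_fun_Gamma_mul {Phi phi} : error_fun_Gamma I Phi ->
  error_fun I phi -> decreasing_on I phi ->
  error_fun_Gamma I (fun t => phi t * Phi t).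
Proof.
move=> [Phi_ge0 PhiG] phi_ge0 phi_decr; apply: error_fun_Gamma_pos.
  by move=> t tI; apply: mulr_ge0; [exact: phi_ge0|exact: Phi_ge0].
move=> x y x0 y0 xyI; have [xI yI xyD] := posdom_summands x0 y0 xyI.
have phi_x : phi (x + y) <= phi x by apply: phi_decr; rewrite // lerDl ltW.
have phi_y : phi (x + y) <= phi y by apply: phi_decr; rewrite // lerDr ltW.
apply: (@le_trans _ _ (phi (x + y) * (Phi x + (2 * x + y) / y * Phi y))).
  by apply: ler_wpM2l; [exact/phi_ge0/posdom_dom|exact: PhiG (ltW x0) y0 xyI].
rewrite mulrDr lerD //.
  by apply: ler_wpM2r phi_x; exact/Phi_ge0/posdom_dom.
rewrite mulrCA; apply: ler_wpM2l.
  by rewrite divr_ge0 ?addr_ge0 ?mulr_ge0 // ltW.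
by apply: ler_wpM2r phi_y; exact/Phi_ge0/posdom_dom.
Qed.

Lemma error_fun_Gamma_eq_pos {Phi Psi} : error_fun I Psi ->
  (forall t, 0 < t -> Psi t = Phi t) ->
  error_fun_Gamma I Phi -> error_fun_Gamma I Psi.
Proof.
move=> Psi_ge0 PsiE [_ PhiG]; apply: error_fun_Gamma_pos => // x y x0 y0 xyI.
by rewrite !PsiE ?addr_gt0 //; apply: PhiG; rewrite // ltW.
Qed.

(** Equality holds: [(x + y) ^+ 2 = x ^+ 2 + (2 * x + y) * y]. *)
Lemma error_fun_Gamma_sqr : error_fun_Gamma I (fun t => t ^+ 2).
Proof.
apply: error_fun_Gamma_pos => [t _|x y _ y0 _]; first exact: sqr_ge0.
by rewrite le_eqVlt; apply/predU1P; left; field; rewrite gt_eqF.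
Qed.

Lemma error_fun_Gamma_decreasing {Psi} : error_fun I Psi ->
  decreasing_on I (fun t => t ^- 2 * Psi t) -> error_fun_Gamma I Psi.
Proof.
move=> Psi_ge0 Psi_decr.
apply: (@error_fun_Gamma_eq_pos (fun t => t ^- 2 * Psi t * t ^+ 2)) => //.
  by move=> t t0; rewrite mulrAC mulVf ?mul1r // expf_neq0 // gt_eqF.
apply: error_fun_Gamma_mul error_fun_Gamma_sqr _ Psi_decr => t tI.
by apply: mulr_ge0; [rewrite invr_ge0 sqr_ge0|exact: Psi_ge0].
Qed.

End PropertyGamma.

Theorem theorem4p1 (R : realType) (I : set R)
    (I_neq0 : I !=set0) (I_open : open I) (I_itv : is_interval I) :
  (forall Phi : R -> R, error_fun_Gamma I Phi ->
     [/\ subadditive_on I (fun t => Num.sqrt (Phi t)),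
         subadditive_on I (fun t => t^-1 * Phi t)
       & forall phi : R -> R, error_fun I phi -> decreasing_on I phi ->
           error_fun_Gamma I (fun t => phi t * Phi t)])
  /\
  (forall Psi : R -> R, error_fun I Psi ->
     decreasing_on I (fun t => t ^- 2 * Psi t) ->
     error_fun_Gamma I Psi).
Proof.
split=> [Phi PhiG|Psi]; last exact: error_fun_Gamma_decreasing.
split; [exact: subadditive_sqrt|exact: subadditive_divt|].
by move=> phi; exact: error_fun_Gamma_mul.
Qed.
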